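(* Let $n\geq 10$ be an even integer. There exists a latin square of order $n$ with at least $\lfloor n/6\rfloor$ pinned entries.
   Context: A latin square of order $n$ is an $n\times n$ array on $n$ symbols in which each symbol occurs exactly once in each row and each column; it is viewed as the set of $n^2$ entries $(r,c,s)$, meaning symbol $s$ is in row $r$, column $c$. A transversal is a set of $n$ entries containing each row, each column and each symbol exactly once. An entry is pinned if the latin square has at least one transversal and the entry belongs to every transversal. *)

(* Defs.v *)
From mathcomp Require Import all_boot.
Set Implicit Arguments. Unset Strict Implicit. Unset Printing Implicit Defensive.

Definition latin_square (n : nat) (L : {ffun 'I_n * 'I_n -> 'I_n}) : Prop :=
  (forall r : 'I_n, forall s : 'I_n, exists! c : 'I_n, L (r, c) = s) /\
  (forall c : 'I_n, forall s : 'I_n, exists! r : 'I_n, L (r, c) = s).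

(* An entry is the triple (r, c, L (r,c)); it is determined by its cell (r,c),
   so we represent sets of entries by sets of cells. *)
Definition transversal n (L : {ffun 'I_n * 'I_n -> 'I_n}) (T : {set 'I_n * 'I_n}) : Prop :=
  #|T| = n /\
  (forall r : 'I_n, #|[set x in T | x.1 == r]| = 1) /\
  (forall c : 'I_n, #|[set x in T | x.2 == c]| = 1) /\
  (forall s : 'I_n, #|[set x in T | L x == s]| = 1).

Definition pinned n (L : {ffun 'I_n * 'I_n -> 'I_n}) (x : 'I_n * 'I_n) : Prop :=
  (exists T, transversal L T) /\ (forall T, transversal L T -> x \in T).

(* Main.v *)
Require Import Defs.
From mathcomp Require Import all_boot.
From mathcomp Require Import zify.
Set Implicit Arguments. Unset Strict Implicit. Unset Printing Implicit Defensive.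

(** Start from the cyclic square [r + c] of order [n = 2m] and permute, column
    by column, the entries inside small blocks of consecutive rows: the symbol
    in cell [(r, c)] becomes [c + f r c] modulo [n], where [f r c] lies in the
    block of [r].  Summing rows, columns and symbols over a transversal shows
    that [n] divides the sum of its shifts [f r c].  The blocks are chosen so
    that the row maxima of [f] add up to exactly [n * m] and the row minima to
    more than [n * (m - 1)]; hence every transversal attains the maximum of [f]
    in every row, and a row whose maximum is attained only once gives a pinned
    entry.

    Most blocks are triples of rows: two rows exchanged on every other column,
    then a single 2x2 subsquare switched so that the middle row has just one
    maximal entry.  A triple exceeds the cyclic square by at most 3 and gives
    one pinned entry, which is the rate needed since the total excess is
    [n / 2].  With triples alone the minima would add up to [n * (m - 1)]; one
    exceptional block, whose largest deficit is smaller than its largest excess,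
    breaks this symmetry and absorbs the residue of [n] modulo 6.  The
    exceptional blocks, and the transversals on them, were found by a computer
    search. *)

(** * Squares obtained from the cyclic one by shifts *)

(** Serves with [phi] the row, the column or the symbol of an entry, each value of which a
    transversal takes exactly once. *)
Lemma sum_fibers1 n (X : finType) (T : {set X}) (phi : X -> 'I_n) (F : nat -> nat) :
  (forall i, #|[set x in T | phi x == i]| = 1) ->
  \sum_(x in T) F (phi x) = \sum_(i < n) F i.
Proof.
move=> fib1; rewrite (partition_big phi predT) //=; apply: eq_bigr => i _.
rewrite (eq_bigr (fun _ => F i)) => [|x /andP[_ /eqP -> //]].
rewrite sum_nat_const -[RHS]mul1n -(fib1 i); congr (_ * _).
by apply: eq_card => x; rewrite !inE.
Qed.

Lemma inj_exists_unique n (g : 'I_n -> 'I_n) :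
  injective g -> forall s, exists! x, g x = s.
Proof.
move=> g_inj s; exists (invF g_inj s); split; first exact: f_invF.
by move=> x <-; rewrite invF_f.
Qed.

Lemma card_graph_fiber n (X : finType) (h : 'I_n -> X) (phi : X -> 'I_n) (i : 'I_n) :
  injective (phi \o h) -> #|[set x in [set h r | r : 'I_n] | phi x == i]| = 1.
Proof.
move=> inj; apply/eqP/cards1P; exists (h (invF inj i)); apply/setP=> x; rewrite !inE.
have fi : phi (h (invF inj i)) = i by exact: (f_invF inj i).
apply/andP/eqP => [[/imsetP[r _ ->] /eqP e]|->]; last by rewrite fi eqxx imset_f.
by congr h; apply: (inj); rewrite /= fi.
Qed.

Section ShiftSquare.

Variables (m n : nat) (f : nat -> nat -> nat) (top bot : nat -> nat) (tau : nat -> nat).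
Hypothesis n_gt0 : 0 < n.

Definition shift_square : {ffun 'I_n * 'I_n -> 'I_n} :=
  [ffun x : 'I_n * 'I_n => Ordinal (ltn_pmod (x.2 + f x.1 x.2) n_gt0)].

Hypothesis row_inj : forall r c c', r < n -> c < n -> c' < n ->
  c + f r c = c' + f r c' %[mod n] -> c = c'.
Hypothesis col_inj : forall r r' c, r < n -> r' < n -> c < n ->
  f r c = f r' c -> r = r'.
Hypothesis f_lt : forall r c, r < n -> c < n -> f r c < n.

Lemma shift_square_latin : latin_square shift_square.
Proof.
split=> [r|c] s; apply: inj_exists_unique => a b /(congr1 val).
  by rewrite !ffunE /= => /row_inj e; apply/val_inj/e.
rewrite !ffunE /= => /eqP; rewrite eqn_modDl !modn_small ?f_lt // => /eqP e.
exact/val_inj/(col_inj (ltn_ord a) (ltn_ord b) (ltn_ord c)).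
Qed.

Hypothesis f_le_top : forall r c, r < n -> c < n -> f r c <= top r.
Hypothesis bot_le_f : forall r c, r < n -> c < n -> bot r <= f r c.
Hypothesis sum_top : \sum_(r < n) top r = n * m.
Hypothesis sum_bot : n * m.-1 < \sum_(r < n) bot r.

(* In any transversal rows, columns and symbols have the same sum, so [n]
   divides the sum of the shifts; [n * m] is the only multiple in range. *)
Lemma transversal_top (T : {set 'I_n * 'I_n}) x :
  Defs.transversal shift_square T -> x \in T -> f x.1 x.2 = top x.1.
Proof.
move=> [_ [rows [cols syms]]] xT.
pose K := \sum_(y in T) (y.2 + f y.1 y.2) %/ n.
have sumE : \sum_(y in T) f y.1 y.2 = K * n.
  have /eqP : \sum_(y in T) (y.2 : nat) + \sum_(y in T) f y.1 y.2 =
              \sum_(y in T) (shift_square y : nat) + K * n.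
    rewrite -big_split /K big_distrl -big_split /=; apply: eq_bigr => y _.
    by rewrite ffunE /= [RHS]addnC -divn_eq.
  rewrite (sum_fibers1 id cols) (sum_fibers1 id syms) eqn_add2l.
  by move/eqP.
have le_top : \sum_(y in T) f y.1 y.2 <= n * m.
  by rewrite -sum_top -(sum_fibers1 top rows); apply: leq_sum => y _; apply: f_le_top.
have gt_bot : n * m.-1 < \sum_(y in T) f y.1 y.2.
  apply: leq_trans sum_bot _; rewrite -(sum_fibers1 bot rows).
  by apply: leq_sum => y _; apply: bot_le_f.
have Km : K = m by move: le_top gt_bot; rewrite sumE mulnC leq_pmul2l // ltn_pmul2l //; lia.
(* One entry below its row maximum would push the total shift below [n * m]. *)
apply/eqP; rewrite eqn_leq f_le_top //= leqNgt; apply/negP => lt_x.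
have : \sum_(y in T) f y.1 y.2 < \sum_(y in T) top y.1.
  rewrite (bigD1 x) //= [X in _ < X](bigD1 x) //= -addSn leq_add //.
  by apply: leq_sum => y _; apply: f_le_top.
by rewrite (sum_fibers1 top rows) sum_top sumE Km mulnC ltnn.
Qed.

Hypothesis tau_lt : forall r, r < n -> tau r < n.
Hypothesis tau_inj : forall r r', r < n -> r' < n -> tau r = tau r' -> r = r'.
Hypothesis tau_top : forall r, r < n -> f r (tau r) = top r.
Hypothesis tau_sym_inj : forall r r', r < n -> r' < n ->
  tau r + top r = tau r' + top r' %[mod n] -> r = r'.

Let cell (r : 'I_n) : 'I_n * 'I_n := (r, Ordinal (tau_lt (ltn_ord r))).

Lemma tau_transversal : Defs.transversal shift_square [set cell r | r : 'I_n].
Proof.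
split; first by rewrite card_imset ?card_ord // => r r' [].
split=> [i|]; first exact: (card_graph_fiber (phi := fst)).
split=> i.
  apply: (card_graph_fiber (phi := snd)) => r r' [] e.
  exact/val_inj/(tau_inj (ltn_ord r) (ltn_ord r')).
apply: card_graph_fiber => r r' /(congr1 val); rewrite /= !ffunE /= !tau_top // => e.
exact/val_inj/(tau_sym_inj (ltn_ord r) (ltn_ord r')).
Qed.

(** A transversal meets row [r] in one cell, where [transversal_top] forces the maximal shift; only
    one column attains it. *)
Lemma unique_top_pinned (r : 'I_n) :
  (forall c c', c < n -> c' < n -> f r c = top r -> f r c' = top r -> c = c') ->
  pinned shift_square (cell r).
Proof.
move=> uniq_top; split; first by exists [set cell r | r : 'I_n]; exact: tau_transversal.
move=> T tT; have [_ [rows _]] := tT.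
have /eqP/cards1P [[r' c] e] := rows r.
have : (r', c) \in [set x in T | x.1 == r] by rewrite e set11.
rewrite inE => /andP[xT /eqP /= rr']; subst r'.
suff -> : cell r = (r, c) by [].
congr pair; apply/val_inj/uniq_top => //=; first exact: tau_lt.
  exact: tau_top.
exact: (transversal_top tT xT).
Qed.

Variables (k : nat) (prow : nat -> nat).
Hypothesis prow_lt : forall i, i < k -> prow i < n.
Hypothesis prow_inj : forall i i', i < k -> i' < k -> prow i = prow i' -> i = i'.
Hypothesis prow_top : forall i c c', i < k -> c < n -> c' < n ->
  f (prow i) c = top (prow i) -> f (prow i) c' = top (prow i) -> c = c'.

Lemma shift_square_pinned :
  exists L : {ffun 'I_n * 'I_n -> 'I_n},
    latin_square L /\
    exists P : {set 'I_n * 'I_n}, k <= #|P| /\ (forall x, x \in P -> pinned L x).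
Proof.
exists shift_square; split; first exact: shift_square_latin.
exists [set cell (Ordinal (prow_lt (ltn_ord i))) | i : 'I_k]; split.
  rewrite card_imset ?card_ord // => i i' [] e _.
  exact/val_inj/(prow_inj (ltn_ord i) (ltn_ord i')).
move=> _ /imsetP[i _ ->]; apply: unique_top_pinned => /= c c'.
exact: prow_top.
Qed.

End ShiftSquare.

(** * Periodic block patterns *)

(* A pattern on [height G] consecutive rows. [column G q] lists the shifts of
   these rows in the [q]-th column after an origin: explicit on a window, then
   2-periodic. Rows beyond the height keep their cyclic entry, whence the default
   [i] in [off G i], [hi G i] and [lo G i]. *)
Record gadget := Gadget {
  height : nat; even_col : seq nat; odd_col : seq nat; window : seq (seq nat);
  gtop : seq nat; gbot : seq nat }.

Definition column G q :=
  if q < size (window G) then nth [::] (window G) q else if odd q then odd_col G else even_col G.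
Definition off G i q := nth i (column G q) i.
Definition hi G i := nth i (gtop G) i.
Definition lo G i := nth i (gbot G) i.

(** Two coincidences suffice to exclude equal symbols modulo [n]: the third,
    [q' + e q' = q + e q + n], cannot occur once the spread of [e] is below [n]. *)
Definition no_collision n (e : nat -> nat) := forall q q', q < n -> q' < q ->
  q + e q <> q' + e q' /\ q + e q <> q' + e q' + n.

Definition no_collisionb n (e : nat -> nat) :=
  all (fun q => all (fun q' => (q + e q != q' + e q') && (q + e q != q' + e q' + n))
    (iota 0 q)) (iota 0 n).

Lemma no_collisionP n e : no_collisionb n e -> no_collision n e.
Proof.
move=> /allP H q q' qn q'q.
have /allP /(_ q') := H q ltac:(by rewrite mem_iota).
by rewrite mem_iota => /(_ q'q) /andP[/eqP ? /eqP ?].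
Qed.

Definition columns G := [:: even_col G, odd_col G & window G].
Definition gadget_ok G := [&& ~~ odd (size (window G)),
  size (gtop G) == height G, size (gbot G) == height G &
  all (fun c => perm_eq c (iota 0 (height G)) &&
     all (fun i => nth 0 (gbot G) i <= nth 0 c i <= nth 0 (gtop G) i)
       (iota 0 (height G)))
   (columns G)].

Definition rows_ok G n :=
  all (fun i => (hi G i <= lo G i + 4) && no_collisionb n (off G i)) (iota 0 (height G)).

Lemma eqmod_near n x y : x = y %[mod n] -> y < x + n.*2 -> x < y + n.*2 ->
  [\/ x = y, x = y + n | y = x + n].
Proof.
move=> /eqP e lt1 lt2; have [le|lt] := leqP y x.
  move: e; rewrite eqn_mod_dvd // => /dvdnP[[|[|k]]]; rewrite ?mulSn => ek;
    by [constructor 1; lia|constructor 2; lia|lia].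
move: e; rewrite eq_sym eqn_mod_dvd ?(ltnW lt) // => /dvdnP[[|[|k]]]; rewrite ?mulSn => ek;
  by [lia|constructor 3; lia|lia].
Qed.

Section Gadget.
Variables (G : gadget) (okG : gadget_ok G).

Lemma column_in q : column G q \in columns G.
Proof.
rewrite /column !inE; case: ifP => [lt|_]; last by case: ifP; rewrite eqxx ?orbT.
by rewrite (mem_nth _ lt) !orbT.
Qed.

Lemma column_perm q : perm_eq (column G q) (iota 0 (height G)).
Proof. by have /and4P[_ _ _ /allP/(_ _ (column_in q))/andP[]] := okG. Qed.

Lemma size_column q : size (column G q) = height G.
Proof. by rewrite (perm_size (column_perm q)) size_iota. Qed.

Lemma off_ge i q : height G <= i -> off G i q = i.
Proof. by move=> h; rewrite /off nth_default // size_column. Qed.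

Lemma hi_ge i : height G <= i -> hi G i = i.
Proof. by move=> h; rewrite /hi nth_default //; have /and4P[_ /eqP-> _ _] := okG. Qed.

Lemma lo_ge i : height G <= i -> lo G i = i.
Proof. by move=> h; rewrite /lo nth_default //; have /and4P[_ _ /eqP-> _] := okG. Qed.

Lemma off_lt i q : i < height G -> off G i q < height G.
Proof.
move=> h; have : off G i q \in iota 0 (height G).
  by rewrite -(perm_mem (column_perm q)) mem_nth // size_column.
by rewrite mem_iota.
Qed.

Lemma off_lt_ge s i q : height G <= s -> i < s -> off G i q < s.
Proof.
move=> hs lt; have [h|h] := leqP (height G) i; first by rewrite off_ge.
exact: leq_trans (off_lt q h) hs.
Qed.

Lemma off_inj i i' q : off G i q = off G i' q -> i = i'.
Proof.
have [h|h] := leqP (height G) i; have [h'|h'] := leqP (height G) i'.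
- by rewrite !off_ge.
- by rewrite (off_ge q h) => e; have := off_lt q h'; rewrite -e ltnNge h.
- by rewrite (off_ge q h') => e; have := off_lt q h; rewrite e ltnNge h'.
rewrite /off => e; apply/eqP.
rewrite -(nth_uniq i _ _ (_ : uniq (column G q))) ?size_column //.
  by rewrite e; apply/eqP/set_nth_default; rewrite size_column.
by rewrite (perm_uniq (column_perm q)) iota_uniq.
Qed.

Lemma off_bounds i q : lo G i <= off G i q <= hi G i.
Proof.
have [h|h] := leqP (height G) i; first by rewrite off_ge // lo_ge // hi_ge // leqnn.
have /and4P[_ /eqP st /eqP sb /allP/(_ _ (column_in q))/andP[_ /allP/(_ i)]] := okG.
rewrite mem_iota => /(_ h).
by rewrite /off /lo /hi !(set_nth_default 0 i) ?size_column ?st ?sb.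
Qed.

Lemma off_parity i q : size (window G) <= q -> off G i q = off G i (size (window G) + odd q).
Proof.
have /andP[ev _] := okG; rewrite /off /column => h.
by rewrite ltnNge h /= ltnNge leq_addr /= oddD oddb (negPf ev).
Qed.

Lemma off_per i q : size (window G) <= q -> off G i q.+2 = off G i q.
Proof.
by move=> h; rewrite [RHS]off_parity // off_parity //= ?negbK // (leq_trans h) // -addn2 leq_addr.
Qed.

(* A window of even length and a spread of at most 4 let two periodic columns be
   inserted without creating a new collision. *)
Lemma no_collision_step n i :
  size (window G) + 6 <= n -> hi G i <= lo G i + 4 ->
  no_collision n (off G i) -> no_collision n.+2 (off G i).
Proof.
move=> hn hb H q q' qn q'q.
have B x : off G i x <= lo G i + 4 /\ lo G i <= off G i x.
  by have := off_bounds i x; lia.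
have P x : size (window G) + 2 <= x -> off G i x = off G i (x - 2).
  by move=> hx; rewrite -[in LHS](subnK (_ : 2 <= x)) ?addn2 ?off_per; lia.
have [[Bq Bq'] [Bp Bp']] := (B q, B q').
split=> e.
  (* Beyond the first two periodic columns both positions move back by 2; otherwise [q <= q' + 4]
     already lies below [n]. *)
  have [hq'|hq'] := leqP (size (window G) + 2) q'; last by have [||H1 H2] := H q q'; lia.
  have [||H1 _] := H (q - 2) (q' - 2); [lia|lia|].
  by rewrite -(P q) -?(P q') in H1; lia.
(* A wrap-around puts [q] near the end and [q'] near 0, so moving only [q] back by 2 turns [n + 2]
   into [n]. *)
have [||_ H2] := H (q - 2) q'; [lia|lia|].
by rewrite -(P q) in H2; lia.
Qed.

(** Larger orders follow from [n0] two columns at a time; for [n = n0] the window may fill the whole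
    square. *)
Lemma rows_ok_no_collision n0 n i :
  rows_ok G n0 -> n0 <= n -> odd n = odd n0 -> (n0 < n -> size (window G) + 6 <= n0) ->
  no_collision n (off G i).
Proof.
move=> /allP H le par hn.
have [h|h] := leqP (height G) i; first by move=> q q' qn q'q; rewrite !off_ge //; lia.
have [d en] : exists d, n = n0 + d.*2 by exists (n - n0)./2; lia.
have /andP[hb /no_collisionP H0] := H i ltac:(by rewrite mem_iota).
case: d en => [->|d en]; first by rewrite addn0.
have {}hn := hn ltac:(lia); rewrite {}en in le par *.
elim: d.+1 => [|k IH]; first by rewrite addn0.
by rewrite doubleS !addnS; apply: no_collision_step => //; lia.
Qed.

Lemma rows_ok_spread n0 n i : rows_ok G n0 -> 4 < n -> hi G i < n + lo G i.
Proof.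
move=> /allP H n4; have [h|h] := leqP (height G) i; first by rewrite hi_ge ?lo_ge //; lia.
by have /andP[hb _] := H i ltac:(by rewrite mem_iota); lia.
Qed.

(** Columns [W] and [W.+1] represent all periodic columns, which confines the maximum to the
    window. *)
Definition unique_top i :=
  let W := size (window G) in
  [&& off G i W != hi G i, off G i W.+1 != hi G i &
    all (fun q => all (fun q' => [&& off G i q == hi G i & off G i q' == hi G i] ==> (q == q'))
      (iota 0 W)) (iota 0 W)].

Lemma unique_topP i q q' : unique_top i ->
  off G i q = hi G i -> off G i q' = hi G i -> q = q'.
Proof.
move=> /and3P[W0 W1 /allP H].
have inw x : off G i x = hi G i -> x \in iota 0 (size (window G)).
  rewrite mem_iota /= add0n; have [//|h] := ltnP x.
  by rewrite off_parity //; case: (odd x); rewrite ?addn1 ?addn0 => /eqP;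
    rewrite (negPf W0, negPf W1).
move=> e e'; have /allP/(_ _ (inw _ e')) := H _ (inw _ e).
by rewrite e e' eqxx => /eqP.
Qed.

Lemma no_collision_row n i q q' x : no_collision n (off G i) -> hi G i < n + lo G i ->
  q < n -> q' < n ->
  x + (q + off G i q) = x + (q' + off G i q') %[mod n] -> q = q'.
Proof.
move=> H hb; wlog lt : q q' / q' < q.
  move=> W qn q'n e; have [lt|gt|//] := ltngtP q' q; first exact: W.
  by apply/esym/W => //; apply/esym.
move=> qn q'n /eqP; rewrite eqn_modDl => /eqP e.
have [H1 H2] := H q q' qn lt; have Bq := off_bounds i q; have Bq' := off_bounds i q'.
by have [||?|?|?] := eqmod_near e; lia.
Qed.

End Gadget.

(** * The square assembled from triples and one exceptional block *)

(* Rows 0 and 2 are exchanged on the even columns; in the window rows 0 and 1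
   moreover exchange the symbols 1 and 2. *)
Definition triple :=
  Gadget 3 [:: 2; 1; 0] [:: 0; 1; 2] [:: [:: 1; 2; 0]; [:: 1; 0; 2]]
    [:: 2; 2; 2] [:: 0; 0; 0].

Lemma triple_ok : gadget_ok triple. Proof. by []. Qed.

(** 8 is the window length 2 plus the 6 needed to extend to larger orders; the presence of a triple
    gives [n >= 8]. *)
Lemma triple_rows_ok : rows_ok triple 8. Proof. by vm_compute. Qed.

(* The rows are [j] groups of six (a triple followed by three cyclic rows) and a
   last group of [2p + 2] rows carrying the exceptional block [V]. *)
Section Assembly.

Variables (j p w : nat) (V : gadget) (slots : seq (bool * nat)) (pins : seq nat).
Let s := p.*2.+2.
Let m := 3 * j + p.+1.
Let n := 6 * j + s.

Hypothesis okV : gadget_ok V.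
Hypothesis heightV : height V <= s.
Hypothesis spreadV : forall i, hi V i < n + lo V i.
Hypothesis collV : forall i, no_collision n (off V i).
Hypothesis sum_hiV : \sum_(0 <= i < s) hi V i = s * p.+1.
Hypothesis sum_loV : s * p < \sum_(0 <= i < s) lo V i.
Hypothesis w_le : w <= p.+2.

Definition block r := if r < 6 * j then triple else V.
Definition base r := if r < 6 * j then 6 * (r %/ 6) else 6 * j.
(** From one group to the next the origin drops by 3 while [base] rises by 6, so the symbols of
    [tau] advance by 3 and tile intervals, as its columns do. The window of [V] starts [w] columns
    into the second gap of [tau]. *)
Definition origin r := if r < 6 * j then 3 * (j - 1 - r %/ 6) else 6 * j + p + w.
Definition pos r c := (c + n - origin r) %% n.
Definition shift r c := base r + off (block r) (r - base r) (pos r c).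
Definition top r := base r + hi (block r) (r - base r).
Definition bot r := base r + lo (block r) (r - base r).

Lemma n_gt0 : 0 < n. Proof. by rewrite /n /s addnS. Qed.

Lemma base_le r : base r <= r.
Proof. by rewrite /base; case: ifP => h; lia. Qed.

Lemma origin_le r : origin r <= n.
Proof. by rewrite /origin /n /s; case: ifP => h; lia. Qed.

Lemma block_ok r : gadget_ok (block r).
Proof. by rewrite /block; case: ifP. Qed.

Lemma block_coll r i : no_collision n (off (block r) i).
Proof.
rewrite /block; case: ifP => // h.
by apply: (rows_ok_no_collision triple_ok _ triple_rows_ok); rewrite /n /s //; lia.
Qed.

Lemma block_spread r i : hi (block r) i < n + lo (block r) i.
Proof.
rewrite /block; case: ifP => // h.
by apply: (rows_ok_spread triple_ok _ triple_rows_ok); rewrite /n /s; lia.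
Qed.

Lemma shift_range r c : r < n ->
  base r <= shift r c < n /\ (r < 6 * j -> shift r c < base r + 6).
Proof.
move=> rn; rewrite /shift leq_addr /=.
have B := base_le r; move: (pos r c) => q.
rewrite /block /base in B *; case: ifP B => h B.
  have := off_lt_ge triple_ok q (isT : 3 <= 6) (_ : r - 6 * (r %/ 6) < 6).
  by rewrite /n /s; lia.
have := off_lt_ge okV q heightV (_ : r - 6 * j < s); rewrite /n /s in rn *; lia.
Qed.

Lemma base_eq r r' c : r < n -> r' < n -> shift r c = shift r' c ->
  base r = base r' /\ (r < 6 * j) = (r' < 6 * j).
Proof.
move=> rn r'n e; have [/andP[H1 H2] H3] := shift_range c rn.
have [/andP[K1 K2] K3] := shift_range c r'n; rewrite -e in K1 K2 K3.
move: (shift r c) H1 H2 H3 K1 K2 K3 => x; rewrite /base.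
by case: ifP => h; case: ifP => h'; lia.
Qed.

Lemma shift_col_inj r r' c : r < n -> r' < n -> c < n ->
  shift r c = shift r' c -> r = r'.
Proof.
move=> rn r'n cn e; have [eb el] := base_eq rn r'n e.
have eo : block r = block r' by rewrite /block el.
have ep : pos r c = pos r' c.
  by move: eb; rewrite /pos /origin /base el; case: ifP => // h eb; do 3!f_equal; lia.
move: e; rewrite /shift eb eo ep => /addnI /(off_inj (block_ok r')) e.
by have := base_le r; have := base_le r'; lia.
Qed.

Lemma pos_lt r c : pos r c < n. Proof. by rewrite ltn_mod n_gt0. Qed.

Lemma pos_mod r c : c = origin r + pos r c %[mod n].
Proof. by rewrite /pos modnDmr subnKC ?modnDr // (leq_trans (origin_le r)) ?leq_addl. Qed.

Lemma pos_inj r c c' : c < n -> c' < n -> pos r c = pos r c' -> c = c'.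
Proof.
move=> cn c'n e; have := pos_mod r c; rewrite e -pos_mod.
by rewrite !modn_small.
Qed.

Lemma shift_row_inj r c c' : r < n -> c < n -> c' < n ->
  c + shift r c = c' + shift r c' %[mod n] -> c = c'.
Proof.
move=> rn cn c'n e; apply: (pos_inj (r := r)) => //.
apply: (no_collision_row (block_ok r) (x := origin r + base r)
  (block_coll r _) (block_spread r (r - base r))); rewrite ?pos_lt //.
have E x : x + shift r x =
    origin r + base r + (pos r x + off (block r) (r - base r) (pos r x)) %[mod n].
  by rewrite -modnDml (pos_mod r x) modnDml /shift addnACA.
by rewrite -!E.
Qed.

(** Arbitrary [G] covers both [hi] and [lo]. The term [18 * j * (j - 1)] sums the bases of the
    six-row groups. *)
Lemma sum_blocks (G : gadget -> nat -> nat) a b :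
  G triple 0 + G triple 1 + G triple 2 + G triple 3 + G triple 4 + G triple 5 = a ->
  \sum_(0 <= i < s) G V i = b ->
  \sum_(r < n) (base r + G (block r) (r - base r)) = 18 * j * (j - 1) + a * j + 6 * j * s + b.
Proof.
move=> ea eb; rewrite -(big_mkord xpredT (fun r => base r + G (block r) (r - base r))).
rewrite (@big_cat_nat _ _ _ (6 * j)) //=; last exact: leq_addr.
rewrite -addnA; congr (_ + _).
  suff H k : k <= j -> \sum_(0 <= r < 6 * k) (base r + G (block r) (r - base r)) =
      18 * k * (k - 1) + a * k by apply: H.
  elim: k => [|k IH] kj; first by rewrite !muln0 big_geq.
  rewrite mulnS addnC (@big_cat_nat _ _ _ (6 * k)) ?leq_addr //= IH 1?ltnW //.
  rewrite -{1}[6 * k]add0n big_addn addKn /index_iota /= !big_cons big_nil.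
  rewrite /block /base.
  have D i : i < 6 -> (i + 6 * k < 6 * j) * ((i + 6 * k) %/ 6 = k) * (i + 6 * k - 6 * k = i).
    by move=> i6; split; [split|]; lia.
  by rewrite !D //; nia.
rewrite /n -{1}[6 * j]add0n big_addn addKn -eb.
rewrite [LHS](eq_big_nat _ _ (F2 := fun i => 6 * j + G V i)).
  by rewrite big_split sum_nat_const_nat subn0 /= mulnC.
move=> i _; rewrite /block /base ltnNge leq_addl /= addnK //.
Qed.

Lemma sum_top : \sum_(r < n) top r = n * m.
Proof.
rewrite /top (@sum_blocks hi 18 (s * p.+1)) // /n /m /s.
by case: j => [|j']; nia.
Qed.

Lemma sum_bot : n * m.-1 < \sum_(r < n) bot r.
Proof.
(* Here 12 is 0+0+0+3+4+5, against 18 = 2+2+2+3+4+5 for the maxima. The groups only give equality;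
   strictness comes from [sum_loV]. *)
rewrite /bot (@sum_blocks lo 12 _ _ erefl) //.
apply: leq_trans (_ : 18 * j * (j - 1) + 12 * j + 6 * j * s + (s * p).+1 <= _); last first.
  by rewrite leq_add2l.
rewrite /n /m /s.
by case: j => [|j']; nia.
Qed.

(* With the rows, columns and symbols of the six-row groups removed, two gaps of
   [p] and [p + 2] consecutive columns remain, starting at [3j] and [6j + p]: a
   slot [(b, x)] of [slots] is column [x] of the second gap if [b], of the first
   otherwise. *)
Definition tau r :=
  if r < 6 * j then
    3 * (j - 1 - r %/ 6) + (if r %% 6 < 3 then 0 else 3 * j + p) + nth 0 [:: 2; 0; 1] (r %% 3)
  else let: (b, x) := nth (true, 0) slots (r - 6 * j) in (if b then 6 * j + p else 3 * j) + x.

Let slot i := nth (true, 0) slots i.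

(** The bounds on [x + hi V i] describe the two runs of symbols, of lengths [p + 2] and [p], left
    free by the six-row groups. *)
Hypothesis slot_range : forall i, i < s ->
  let: (b, x) := slot i in
  if b then (x < p.+2) && (p < x + hi V i < p.*2.+3)
  else (x < p) && (p < x + hi V i < p.*2.+1).
Hypothesis slot_inj : forall i i', i < s -> i' < s -> slot i = slot i' -> i = i'.
Hypothesis slot_sym_inj : forall i i', i < s -> i' < s ->
  (slot i).1 = (slot i').1 -> (slot i).2 + hi V i = (slot i').2 + hi V i' -> i = i'.
Hypothesis slot_top : forall i, i < s ->
  let: (b, x) := slot i in
  off V i ((if b then x + n - w else 3 * j + p.+2 + x - w) %% n) = hi V i.

Variant row_spec r : Prop :=
| RowTriple g i of g < j & i < 6 & r = 6 * g + i & r < 6 * j & base r = 6 * g &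
    origin r = 3 * (j - 1 - g) &
    tau r = 3 * (j - 1 - g) + (if i < 3 then 0 else 3 * j + p) + nth 0 [:: 2; 0; 1] (i %% 3)
| RowV i of i < s & r = 6 * j + i & r >= 6 * j & base r = 6 * j & origin r = 6 * j + p + w &
    tau r = (if (slot i).1 then 6 * j + p else 3 * j) + (slot i).2.

Lemma rowP r : r < n -> row_spec r.
Proof.
move=> rn; have [h|h] := ltnP r (6 * j).
  apply: (@RowTriple _ (r %/ 6) (r %% 6)); rewrite /base /origin /tau ?h //; try lia.
  by congr (_ + nth _ _ _); lia.
apply: (@RowV _ (r - 6 * j)); rewrite /base /origin /tau ?(ltnNge r) ?h //=; try lia.
by rewrite -/(slot _); case: (slot _).
Qed.

Lemma tau_lt r : r < n -> tau r < n.
Proof.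
move=> /rowP[g i gj i6 -> _ _ _ ->|i si _ _ _ _ ->].
  by case: i i6 => [|[|[|[|[|[|//]]]]]] _ /=; rewrite /n /s; lia.
by have := slot_range si; case: (slot i) => -[] x /=; rewrite /n /s; lia.
Qed.

Lemma tau_inj r r' : r < n -> r' < n -> tau r = tau r' -> r = r'.
Proof.
move=> /rowP[g i gj i6 -> _ _ _ ->|i si -> _ _ _ ->]
       /rowP[g' i' gj' i6' -> _ _ _ ->|i' si' -> _ _ _ ->].
- by case: i i6 => [|[|[|[|[|[|//]]]]]] _ /=; case: i' i6' => [|[|[|[|[|[|//]]]]]] _ /=; lia.
- have := slot_range si'; case: (slot i') => -[] x /=;
    by case: i i6 => [|[|[|[|[|[|//]]]]]] _ /=; lia.
- have := slot_range si; case: (slot i) => -[] x /=;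
    by case: i' i6' => [|[|[|[|[|[|//]]]]]] _ /=; lia.
move=> e; congr (_ + _); apply: slot_inj => //.
move: (slot_range si) (slot_range si') e.
by case: (slot i) (slot i') => -[] x [[] x'] /=; move=> H H' e; first [congr pair; lia | lia].
Qed.

Lemma tau_top r : r < n -> shift r (tau r) = top r.
Proof.
move=> rn; rewrite /shift /top; congr (_ + _); rewrite /pos /block.
case: (rowP rn) => [g i gj i6 er h eb eo et|i si er h eb eo et].
  rewrite h eb eo et er addKn.
  have [i3|i3] := ltnP i 3; last by rewrite off_ge ?hi_ge.
  rewrite (_ : _ - _ = nth 0 [:: 2; 0; 1] (i %% 3) + n); last by lia.
  rewrite modnDr modn_small; last by rewrite /n /s; case: i i3 {er i6 et} => [|[|[|//]]] _ /=; lia.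
  by case: i i3 {er i6 et} => [|[|[|//]]].
rewrite ltnNge h /= eb eo et er addKn.
move: (slot_range si) (slot_top si); case: (slot i) => -[] x /= H <-;
  by congr (off V i (_ %% _)); rewrite /n /s; lia.
Qed.

(* After subtracting [n] on the second gap, the values [tau r + top r] run through
   [n] consecutive integers. *)
Lemma tau_sym_inj r r' : r < n -> r' < n ->
  tau r + top r = tau r' + top r' %[mod n] -> r = r'.
Proof.
move=> rn r'n; rewrite /top /block.
have D (g i : nat) : i < 6 -> hi triple i = nth 0 [:: 2; 2; 2; 3; 4; 5] i.
  by case: i => [|[|[|[|[|[|//]]]]]].
case: (rowP rn) (rowP r'n)
  => [g i gj i6 er h -> _ ->|i si er h -> _ ->]
     [g' i' gj' i6' er' h' -> _ ->|i' si' er' h' -> _ ->].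
- rewrite h h' er er' !addKn !D // => /eqmod_near e {h h' er er'}.
  case: i i6 e => [|[|[|[|[|[|//]]]]]] _ /=; case: i' i6' => [|[|[|[|[|[|//]]]]]] _ /= [];
  rewrite /n /s; lia.
- rewrite h (ltnNge r') h' er er' !addKn D //= => /eqmod_near e {h h' er er'}; exfalso.
  have := slot_range si'; case: (slot i') e => -[] x /=;
    case: i i6 => [|[|[|[|[|[|//]]]]]] _ /= H1 H2; case: H1; move: H2; rewrite /n /s; lia.
- rewrite h' (ltnNge r) h er er' !addKn D //= => /eqmod_near e {h h' er er'}; exfalso.
  have := slot_range si; case: (slot i) e => -[] x /=;
    case: i' i6' => [|[|[|[|[|[|//]]]]]] _ /= H1 H2; case: H1; move: H2; rewrite /n /s; lia.
rewrite (ltnNge r) (ltnNge r') h h' er er' !addKn /= => /eqmod_near e {h h' er er'}; congr (_ + _).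
have /andP[] : ((slot i).1 == (slot i').1) && ((slot i).2 + hi V i == (slot i').2 + hi V i').
  move: (slot_range si) (slot_range si') e.
  by case: (slot i) (slot i') => -[] x [[] x'] /= H H' []; rewrite /n /s; lia.
by move=> /eqP e1 /eqP e2; apply: slot_sym_inj.
Qed.

Hypothesis pins_uniq : uniq pins.
Hypothesis pins_lt : forall i : nat, i \in pins -> i < s.
Hypothesis pins_top : forall i : nat, i \in pins -> unique_top V i.

(** Row [6 * k + 1] is the middle row of a triple. *)
Definition pinned_row k := if k < j then 6 * k + 1 else 6 * j + nth 0 pins (k - j).

Lemma assembly_pinned :
  exists L : {ffun 'I_n * 'I_n -> 'I_n},
    latin_square L /\
    exists P : {set 'I_n * 'I_n},
      j + size pins <= #|P| /\ (forall x, x \in P -> pinned L x).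
Proof.
have in_pins k : k < j + size pins -> j <= k -> nth 0 pins (k - j) \in pins.
  by move=> lt le; rewrite mem_nth // ltn_subLR.
apply: (@shift_square_pinned m n shift top bot tau n_gt0 shift_row_inj shift_col_inj _ _ _
  sum_top sum_bot tau_lt tau_inj tau_top tau_sym_inj _ pinned_row).
- by move=> r c rn _; have [/andP[]] := shift_range c rn.
1,2: by move=> r c _ _; rewrite leq_add2l;
  have /andP[] := off_bounds (block_ok r) (r - base r) (pos r c).
- move=> k kk; rewrite /pinned_row; case: (ltnP k j) => h; first by rewrite /n; lia.
  by have := pins_lt (in_pins k kk h); rewrite /n; lia.
- move=> k k' kk kk'; rewrite /pinned_row; case: (ltnP k j) => h; case: (ltnP k' j) => h'; try lia.
  by move=> /addnI /eqP; rewrite nth_uniq ?ltn_subLR //; move/eqP; lia.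
move=> k c c' kk cn c'n /addnI e /addnI e'; apply: (pos_inj (r := pinned_row k)) => //.
apply: unique_topP e e'; first exact: block_ok.
rewrite /block /base /pinned_row; case: (ltnP k j) => h.
  have -> : 6 * k + 1 < 6 * j by lia.
  by have -> : 6 * k + 1 - 6 * ((6 * k + 1) %/ 6) = 1 by lia.
have -> : (6 * j + nth 0 pins (k - j) < 6 * j) = false by rewrite ltnNge leq_addr.
by rewrite addKn; apply/pins_top/in_pins.
Qed.

End Assembly.

(** * The exceptional blocks *)

(* [j0] and [oddj] stand for [j == 0] and [odd j]: nothing else about [j] matters,
   since outside its window a gadget only depends on the parity of the column. *)
Definition core_ok (p w : nat) (V : gadget) (pins : seq nat)
    (slots : seq (bool * nat)) (j0 oddj : bool) :=
  let s := p.*2.+2 in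
  let W := size (window V) in
  let slot i := nth (true, 0) slots i in
  [&& [&& gadget_ok V, rows_ok V s, height V <= s, 1 < p, w <= p.+2 & W + w <= s],
   j0 || (W + 6 <= s) && (W + w <= p + 5),
   (sumn (map (hi V) (iota 0 s)) == s * p.+1) && (s * p < sumn (map (lo V) (iota 0 s))),
   uniq (mkseq slot s) && uniq (mkseq (fun i => ((slot i).1, (slot i).2 + hi V i)) s),
   all (fun i => let: (b, x) := slot i in
     (if b then (x < p.+2) && (p < x + hi V i < p.*2.+3)
      else (x < p) && (p < x + hi V i < p.*2.+1)) &&
     (off V i (if b then if w <= x then x - w else W + odd (x + w)
               else if j0 then p.+2 + x - w else W + odd (oddj + p + x + w)) == hi V i))
    (iota 0 s) &
   uniq pins && all (fun i => (i < s) && unique_top V i) pins].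

Lemma core_pinned j p w V pins slots : core_ok p w V pins slots (j == 0) (odd j) ->
  let n := 6 * j + p.*2.+2 in
  exists L : {ffun 'I_n * 'I_n -> 'I_n},
    latin_square L /\
    exists P : {set 'I_n * 'I_n},
      j + size pins <= #|P| /\ (forall x, x \in P -> pinned L x).
Proof.
move=> /and5P[/and5P[okV rowsV hV p1 /andP[wp Ww]] hj /andP[/eqP sumT sumB]
  /andP[/mkseq_uniqP u1 /mkseq_uniqP u2]
  /andP[/allP slotsP /andP[upins /allP pinsP]]] n.
have sumE (F : nat -> nat) s : \sum_(0 <= i < s) F i = sumn (map F (iota 0 s)).
  by rewrite sumnE big_map /index_iota subn0.
apply: (@assembly_pinned j p w V slots pins) => //; rewrite ?sumE //.
- by move=> i; apply: (rows_ok_spread okV _ rowsV); lia.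
- move=> i; apply: (rows_ok_no_collision okV _ rowsV); lia.
- by move=> i si; have := slotsP i; rewrite mem_iota => /(_ si); case: nth => b x /andP[].
- by move=> i i' si si' e1 e2; apply: (u2 i i') => //=; rewrite e1 e2.
- move=> i si; have := slotsP i; rewrite mem_iota => /(_ si).
  have ev : odd (size (window V)) = false by apply/negbTE; case/andP: okV.
  case: nth => -[] x /andP[/andP[H _] /eqP <-]; rewrite -/n.
    case: leqP => [le|lt].
      by rewrite (_ : x + n - w = x - w + n) ?modnDr ?modn_small; rewrite /n; lia.
    rewrite modn_small; last by rewrite /n; lia.
    rewrite off_parity //; last by rewrite /n; lia.
    by congr (off V i (_ + nat_of_bool _)); rewrite /n; lia.
  rewrite modn_small; last by rewrite /n; lia.
  (* For [j > 0], the bound [W + w <= p + 5] places the first gap past the window, where only parity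
     matters. *)
  case: eqP hj => [->|/= j0 /andP[_ hj]]; first by rewrite muln0.
  rewrite off_parity //; last by lia.
  by congr (off V i (_ + nat_of_bool _)); lia.
- by move=> i /pinsP/andP[].
by move=> i /pinsP/andP[].
Qed.

Definition lft (x : nat) := (false, x).
Definition rgt (x : nat) := (true, x).

(* For [n = 10] the window is the whole square. *)
Definition core10 :=
  Gadget 4 [:: 0; 1; 2; 3] [:: 0; 1; 2; 3]
    [:: [:: 3; 1; 2; 0]; [:: 3; 1; 2; 0]; [:: 0; 1; 2; 3]; [:: 3; 1; 2; 0]; [:: 1; 3; 2; 0];
        [:: 3; 0; 2; 1]; [:: 1; 0; 2; 3]; [:: 3; 1; 2; 0]; [:: 3; 1; 2; 0]; [:: 0; 1; 2; 3]]
    [:: 3; 3; 2; 3] [:: 0; 0; 2; 0].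

Definition slots10 :=
  [:: rgt 3; rgt 4; lft 3; rgt 2; lft 2; rgt 5; lft 1; rgt 1; lft 0; rgt 0].

Definition core12 :=
  Gadget 4 [:: 2; 0; 3; 1] [:: 0; 2; 1; 3]
    [:: [:: 3; 0; 2; 1]; [:: 0; 1; 2; 3]; [:: 0; 3; 2; 1]; [:: 1; 0; 2; 3]]
    [:: 3; 3; 3; 3] [:: 0; 0; 1; 1].

Definition slots12 oddj := if oddj
  then [:: rgt 3; rgt 5; lft 3; rgt 4; lft 4; lft 2; rgt 6; rgt 2; lft 1; rgt 1; lft 0; rgt 0]
  else [:: rgt 3; rgt 5; lft 4; rgt 4; lft 2; lft 3; rgt 6; rgt 2; lft 1; rgt 1; lft 0; rgt 0].

Definition core14 :=
  Gadget 5 [:: 1; 2; 0; 4; 3] [:: 1; 0; 4; 2; 3]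
    [:: [:: 2; 1; 0; 3; 4]; [:: 0; 3; 1; 4; 2]; [:: 1; 0; 3; 2; 4]; [:: 1; 0; 4; 3; 2]]
    [:: 2; 3; 4; 4; 4] [:: 0; 0; 0; 2; 2].

Definition slots14 oddj := if oddj
  then [:: rgt 5; rgt 6; lft 3; lft 4; rgt 7; rgt 3; lft 5; lft 2; rgt 2; lft 1; rgt 4; rgt 1;
           lft 0; rgt 0]
  else [:: rgt 5; rgt 6; lft 4; lft 3; rgt 7; lft 5; rgt 2; lft 2; rgt 4; rgt 1; lft 1; rgt 3;
           lft 0; rgt 0].

Definition core16 :=
  Gadget 7 [:: 2; 0; 3; 1; 4; 5; 6] [:: 0; 2; 1; 3; 6; 5; 4]
    [:: [:: 3; 0; 2; 1; 4; 5; 6]; [:: 0; 1; 2; 3; 6; 5; 4]; [:: 0; 3; 2; 1; 4; 5; 6];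
        [:: 1; 0; 2; 3; 6; 5; 4]]
    [:: 3; 3; 3; 3; 6; 5; 6] [:: 0; 0; 1; 1; 4; 5; 4].

Definition slots16 oddj := if oddj
  then [:: rgt 5; rgt 7; lft 5; rgt 6; lft 4; lft 6; lft 3; rgt 4; rgt 8; rgt 3; lft 2; rgt 2;
           lft 1; rgt 1; lft 0; rgt 0]
  else [:: rgt 5; rgt 7; lft 6; rgt 6; lft 5; lft 3; lft 4; rgt 4; rgt 8; rgt 3; lft 2; rgt 2;
           lft 1; rgt 1; lft 0; rgt 0].

Lemma core10_ok : core_ok 4 0 core10 [:: 1] slots10 true false.
Proof. by vm_compute. Qed.

Lemma core12_ok j : core_ok 5 3 core12 [:: 0; 1] (slots12 (odd j)) (j == 0) (odd j).
Proof. by case: j => [|j] /=; last case: (odd j); vm_compute. Qed.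

Lemma core14_ok j : core_ok 6 5 core14 [:: 0; 1] (slots14 (odd j)) (j == 0) (odd j).
Proof. by case: j => [|j] /=; last case: (odd j); vm_compute. Qed.

Lemma core16_ok j : core_ok 7 5 core16 [:: 0; 1] (slots16 (odd j)) (j == 0) (odd j).
Proof. by case: j => [|j] /=; last case: (odd j); vm_compute. Qed.

Theorem theorem1 (n : nat) (Hn : 10 <= n) (Hev : ~~ odd n) :
  exists L : {ffun 'I_n * 'I_n -> 'I_n},
    latin_square L /\
    exists P : {set 'I_n * 'I_n},
      n %/ 6 <= #|P| /\ (forall x, x \in P -> pinned L x).
Proof.
suff [j [p [w [V [pins [slots [ok en sz]]]]]]] : exists j p w V pins slots,
    [/\ core_ok p w V pins slots (j == 0) (odd j), n = 6 * j + p.*2.+2 & n %/ 6 <= j + size pins].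
  rewrite {}en in Hn Hev sz *; have [L [latL [P [leP pinP]]]] := core_pinned ok.
  by exists L; split=> //; exists P; split=> //; apply: leq_trans leP.
have [->|n10] := eqVneq n 10.
  by exists 0, 4, 0, core10, [:: 1], slots10; split=> //; exact: core10_ok.
(* Residues 0, 2, 4 modulo 6 select the block; each has two pins, matching [n %/ 6 = j + 2]. *)
have : exists2 j, 12 <= n & [\/ n = 6 * j + 12, n = 6 * j + 14 | n = 6 * j + 16].
  exists ((n - 12) %/ 6); first by lia.
  have := divn_eq n 6; have := ltn_pmod n (isT : 0 < 6).
  case: (n %% 6) => [|[|[|[|[|[|//]]]]]] _ e;
    by [lia|constructor 1; lia|constructor 2; lia|constructor 3; lia].
case=> j _ []->.
- exists j, 5, 3, core12, [:: 0; 1], (slots12 (odd j)); split=> //=; [exact: core12_ok|lia].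
- exists j, 6, 5, core14, [:: 0; 1], (slots14 (odd j)); split=> //=; [exact: core14_ok|lia].
exists j, 7, 5, core16, [:: 0; 1], (slots16 (odd j)); split=> //=; [exact: core16_ok|lia].
Qed.
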